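(* Let $p$ be a prime and suppose $q\in U^{(1)}$. Then the number of fixed points for $[\iota_q]_{p^n}$ is asymptotically stable (that is, constant for all large enough $n$) for all $q$ and all $p$, except when $p=3$ and $q=q_0$ or $q=q_1$, in which case the number grows without bound as $n$ goes to infinity.
   Context: $\mathbb{Z}_p$ is the ring of $p$-adic integers and $U^{(m)}=1+p^m\mathbb{Z}_p$. For $q\in U^{(1)}$, $\iota_q:\mathbb{Z}_p\to\mathbb{Z}_p$ is the unique continuous function with $\iota_q(k)=1+q+\cdots+q^{k-1}$ for all integers $k\ge 0$, and $[\iota_q]_{p^n}:\mathbb{Z}_p\to\mathbb{Z}/p^n\mathbb{Z}$ is its reduction modulo $p^n$. A fixed point of $[\iota_q]_{p^n}$ is an element $z\in\mathbb{Z}_p$ with $\iota_q(z)\equiv z\pmod{p^n}$; fixed points are counted modulo $p^n\mathbb{Z}_p$. Every $\iota_q$ fixes $0$ and $1$ (the trivial fixed points). For $p=3$, $q_0$ and $q_1$ denote the unique elements of $U^{(1)}-U^{(2)}$ with $q_0\equiv 7\pmod 9$ and $q_1\equiv 4\pmod 9$ such that $\iota_{q_0}$ and $\iota_{q_1}$ have no nontrivial fixed points in $\mathbb{Z}_3$ (their existence and uniqueness is a result of the same paper).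
   Formalization: The case q = 1 is excluded: it lies in U^(1), but ι_1 is the identity, so the number of fixed points modulo p^n is p^n, which is not asymptotically stable, and 1 is neither q_0 nor q_1. *)

(* Defs.v *)
From HB Require Import structures.
From mathcomp Require Import all_boot all_order all_algebra.
From mathcomp Require Import all_classical all_reals topology.

Set Implicit Arguments.
Unset Strict Implicit.
Unset Printing Implicit Defensive.

Import Order.TTheory GRing.Theory Num.Theory.
Local Open Scope classical_set_scope.
Local Open Scope ring_scope.

(* Z_p as the inverse limit of the rings Z/p^n; the component red x n in Z/p^n
   is the canonical representative, an integer in [0, p^n) when p > 0.        *)
Record padic (p : nat) := Padic {
  red : nat -> int;
  redP : forall n, red n = (red n.+1 %% (p ^ n)%N%:Z)%Z
}.

Section PadicRing.
Variable p : nat.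
Implicit Types (x y z : padic p) (n : nat).

Lemma padic_ext x y : red x =1 red y -> x = y.
Proof.
case: x y => [x hx] [y hy] /= /funext exy; case: _ / exy hy => hy.
by congr Padic; exact: Prop_irrelevance.
Qed.

Lemma red_mod x n : (red x n %% (p ^ n)%N%:Z)%Z = red x n.
Proof. by rewrite redP modz_mod. Qed.

Lemma modz_expS (a : int) n :
  ((a %% (p ^ n.+1)%N%:Z)%Z %% (p ^ n)%N%:Z)%Z = (a %% (p ^ n)%N%:Z)%Z.
Proof.
apply/eqP; rewrite eqz_mod_dvd.
have dv : ((p ^ n)%N%:Z %| (p ^ n.+1)%N%:Z)%Z.
  by rewrite dvdzE /= dvdn_exp2l.
apply: (dvdz_trans dv); rewrite -eqz_mod_dvd modz_mod; exact: eqxx.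
Qed.

Fact const_coh (a : int) n :
  (a %% (p ^ n)%N%:Z)%Z = ((a %% (p ^ n.+1)%N%:Z)%Z %% (p ^ n)%N%:Z)%Z.
Proof. by rewrite modz_expS. Qed.

Fact opp_coh x n :
  (- red x n %% (p ^ n)%N%:Z)%Z =
  ((- red x n.+1 %% (p ^ n.+1)%N%:Z)%Z %% (p ^ n)%N%:Z)%Z.
Proof. by rewrite modz_expS [red x n]redP modzNm. Qed.

Fact add_coh x y n :
  ((red x n + red y n) %% (p ^ n)%N%:Z)%Z =
  (((red x n.+1 + red y n.+1) %% (p ^ n.+1)%N%:Z)%Z %% (p ^ n)%N%:Z)%Z.
Proof. by rewrite modz_expS [red x n]redP [red y n]redP modzDm. Qed.

Fact mul_coh x y n :
  ((red x n * red y n) %% (p ^ n)%N%:Z)%Z =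
  (((red x n.+1 * red y n.+1) %% (p ^ n.+1)%N%:Z)%Z %% (p ^ n)%N%:Z)%Z.
Proof. by rewrite modz_expS [red x n]redP [red y n]redP modzMm. Qed.

Definition padic_const (a : int) := Padic (const_coh a).
Definition padic_opp x := Padic (opp_coh x).
Definition padic_add x y := Padic (add_coh x y).
Definition padic_mul x y := Padic (mul_coh x y).

HB.instance Definition _ := gen_eqMixin (padic p).
HB.instance Definition _ := gen_choiceMixin (padic p).

Fact padic_addA : associative padic_add.
Proof. by move=> x y z; apply: padic_ext => n /=; rewrite modzDmr modzDml addrA. Qed.

Fact padic_addC : commutative padic_add.
Proof. by move=> x y; apply: padic_ext => n /=; rewrite addrC. Qed.

Fact padic_add0 : left_id (padic_const 0) padic_add.
Proof. by move=> x; apply: padic_ext => n /=; rewrite modzDml add0r red_mod. Qed.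

Fact padic_addN : left_inverse (padic_const 0) padic_opp padic_add.
Proof. by move=> x; apply: padic_ext => n /=; rewrite modzDml addNr. Qed.

HB.instance Definition _ :=
  GRing.isZmodule.Build (padic p) padic_addA padic_addC padic_add0 padic_addN.

Fact padic_mulA : associative padic_mul.
Proof. by move=> x y z; apply: padic_ext => n /=; rewrite modzMmr modzMml mulrA. Qed.

Fact padic_mulC : commutative padic_mul.
Proof. by move=> x y; apply: padic_ext => n /=; rewrite mulrC. Qed.

Fact padic_mul1 : left_id (padic_const 1) padic_mul.
Proof. by move=> x; apply: padic_ext => n /=; rewrite modzMml mul1r red_mod. Qed.

Fact padic_mulD : left_distributive padic_mul padic_add.
Proof.
by move=> x y z; apply: padic_ext => n /=; rewrite modzDm modzMml mulrDl.
Qed.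

HB.instance Definition _ := GRing.Zmodule_isComPzRing.Build (padic p)
  padic_mulA padic_mulC padic_mul1 padic_mulD.

(* The p-adic topology is given by the uniformity of congruence modulo p^n.   *)
Definition padic_entourage : set_system (padic p * padic p) :=
  [set A | exists n, forall x y, red x n = red y n -> A (x, y)].

Lemma red_le x y m n : (m <= n)%N -> red x n = red y n -> red x m = red y m.
Proof.
elim: n => [|n IHn]; first by rewrite leqn0 => /eqP ->.
rewrite leq_eqVlt => /predU1P [-> //|]; rewrite ltnS => /IHn {}IHn e.
by apply: IHn; rewrite redP e -redP.
Qed.

Fact padic_ent_filter : Filter padic_entourage.
Proof.
split; first by exists 0%N.
- move=> A B [m hA] [n hB]; exists (maxn m n) => x y e; split.
  + by apply: hA; apply: red_le e; exact: leq_maxl.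
  + by apply: hB; apply: red_le e; exact: leq_maxr.
- by move=> A B AB [n hA]; exists n => x y /hA /AB.
Qed.

Fact padic_ent_diag A : padic_entourage A -> diagonal `<=` A.
Proof. by move=> [n hA] [x y] e; apply: hA; rewrite (e : x = y). Qed.

Fact padic_ent_inv A : padic_entourage A -> padic_entourage (A^-1)%relation.
Proof. by move=> [n hA]; exists n => x y /= e; exact: hA. Qed.

Fact padic_ent_split A : padic_entourage A ->
  exists2 B, padic_entourage B & (B \; B `<=` A)%relation.
Proof.
move=> [n hA]; exists [set xy | red xy.1 n = red xy.2 n]; first by exists n.
by move=> [x z] /= [y /= exy eyz]; apply: hA; rewrite exy.
Qed.

HB.instance Definition _ := isUniform.Build (padic p)
  padic_ent_filter padic_ent_diag padic_ent_inv padic_ent_split.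

End PadicRing.

Section FixedPoints.
Variable p : nat.
Implicit Types (q x y z : padic p) (n : nat).

(* U m = 1 + p^m Z_p *)
Definition U (m : nat) : set (padic p) :=
  [set q | exists c, q = 1 + p%:R ^+ m * c].

Definition iota_spec q : set (padic p -> padic p) :=
  [set f : padic p -> padic p | continuous f /\
    forall k : nat, f k%:R = \sum_(i < k) q ^+ i].

(* The unique continuous extension of k |-> 1 + q + ... + q^(k-1), for
   q in U 1 (see iota_specP and iota_unique below).                           *)
Definition iota_q q : padic p -> padic p := xget (fun=> 0) (iota_spec q).

(* z is a fixed point of the reduction of iota_q modulo p^n *)
Definition fixed_mod q n z := red (iota_q q z) n = red z n.

(* The number of fixed points modulo p^n, i.e. of classes in Z/p^n containing
   a fixed point of the reduction of iota_q.                                  *)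
Definition nfix q n : nat :=
  #|[pred c : 'I_(p ^ n) | `[< exists2 z, fixed_mod q n z & red z n = c :> int >]]|.

Definition no_nontrivial_fixpoint q :=
  forall z, iota_q q z = z -> z = 0 \/ z = 1.

(* For p = 3, q is the exceptional element congruent to a modulo 9:
   q = q_0 for a = 7 and q = q_1 for a = 4.                                   *)
Definition is_exceptional (a : nat) q :=
  unique (fun x => [/\ (U 1 `\` U 2) x, red x 2 = red (a%:R : padic p) 2
                     & no_nontrivial_fixpoint x]) q.

End FixedPoints.

Section Iota.
Variable p : nat.
Hypothesis p_gt0 : (0 < p)%N.
Implicit Types (q x y z : padic p) (n : nat).

Lemma padic_natE (k : nat) n : red (k%:R : padic p) n = (k%:Z %% (p ^ n)%N%:Z)%Z.
Proof.
elim: k => [|k IHk] /=; first by [].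
by rewrite -natr1 /= IHk modzDm -[k.+1]addn1 PoszD.
Qed.

Lemma padic_redD x y n : red (x + y) n = ((red x n + red y n) %% (p ^ n)%N%:Z)%Z.
Proof. by []. Qed.

Lemma padic_redM x y n : red (x * y) n = ((red x n * red y n) %% (p ^ n)%N%:Z)%Z.
Proof. by []. Qed.

Lemma padic_redX q k n : red (q ^+ k) n = (red q n ^+ k %% (p ^ n)%N%:Z)%Z.
Proof.
elim: k => [|k IHk]; first by [].
by rewrite exprS padic_redM IHk modzMmr -exprS.
Qed.

Lemma padic_red_sum q k n : red (\sum_(i < k) q ^+ i) n =
  ((\sum_(i < k) red q n ^+ i) %% (p ^ n)%N%:Z)%Z.
Proof.
elim: k => [|k IHk]; first by rewrite !big_ord0.
by rewrite !big_ord_recr padic_redD IHk padic_redX modzDm.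
Qed.

Lemma red_absz x n : (`|red x n|%N)%:Z = red x n.
Proof.
by rewrite gez0_abs // -red_mod modz_ge0 // eqz_nat -lt0n expn_gt0 p_gt0.
Qed.

Lemma geo_sumD (Q : int) a b : \sum_(i < a + b) Q ^+ i =
  \sum_(i < a) Q ^+ i + Q ^+ a * \sum_(i < b) Q ^+ i.
Proof.
rewrite big_split_ord /= mulr_sumr; congr (_ + _).
by apply: eq_bigr => i _; rewrite exprD.
Qed.

Lemma dvdz_geo_sum (Q : int) n : (p%:Z %| Q - 1)%Z ->
  ((p ^ n)%N%:Z %| \sum_(i < p ^ n) Q ^+ i)%Z.
Proof.
move=> dQ; elim: n => [|n IHn]; first by rewrite expn0 dvd1z.
have geoM b : \sum_(i < p ^ n * b) Q ^+ i =
    (\sum_(i < p ^ n) Q ^+ i) * \sum_(j < b) (Q ^+ (p ^ n)) ^+ j.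
  elim: b => [|b IHb]; first by rewrite muln0 !big_ord0 mulr0.
  by rewrite mulnS addnC geo_sumD IHb big_ord_recr /= mulrDr -exprM; congr (_ + _); rewrite mulrC.
rewrite expnSr geoM PoszM; apply: dvdz_mul => //.
have dX m : (Q ^+ m = 1 %[mod p%:Z])%Z.
  have dQ1 : (Q = 1 %[mod p%:Z])%Z by apply/eqP; rewrite eqz_mod_dvd.
  by rewrite -modzXm dQ1 modzXm expr1n.
have -> : (p%:Z = \sum_(j < p) 1 :> int) by rewrite sumr_const card_ord natz.
apply/dvdz_mod0P; rewrite sumr_const card_ord natz.
have sumE b : (\sum_(j < b) (Q ^+ (p ^ n)) ^+ j = b%:Z %[mod p%:Z])%Z.
  elim: b => [|b IHb]; first by rewrite big_ord0.
  by rewrite big_ord_recr -modzDm IHb -exprM dX modzDm -[b.+1]addn1 PoszD.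
by rewrite sumE modzz.
Qed.

Lemma geo_sum_modn (Q : int) n a : (p%:Z %| Q - 1)%Z ->
  (\sum_(i < a) Q ^+ i = \sum_(i < (a %% p ^ n)%N) Q ^+ i %[mod (p ^ n)%N%:Z])%Z.
Proof.
move=> dQ; have -> : \sum_(i < a) Q ^+ i =
    \sum_(i < a %% p ^ n + a %/ p ^ n * p ^ n) Q ^+ i by rewrite addnC -divn_eq.
rewrite geo_sumD.
apply/eqP; rewrite eqz_mod_dvd addrAC subrr add0r.
apply: dvdz_mull; elim: (a %/ _)%N => [|b IHb]; first by rewrite big_ord0 dvdz0.
by rewrite mulSn geo_sumD rpredD ?dvdz_mull ?dvdz_geo_sum.
Qed.

Lemma U1_red q n : U 1 q -> (p%:Z %| red q n.+1 - 1)%Z.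
Proof.
case=> c ->; rewrite expr1.
have H : red (1 + p%:R * c) 1 = red (1 : padic p) 1.
  by rewrite padic_redD padic_redM padic_natE expn1 modzz mul0r mod0z addr0 red_mod.
have HH : forall m, (red (1 + p%:R * c) m.+1 = 1 %[mod p%:Z])%Z.
  elim=> [|m IHm]; first by rewrite H /= expn1 modz_mod.
  rewrite -IHm [in RHS]redP; apply/esym/eqP; rewrite eqz_mod_dvd.
  apply: (@dvdz_trans (p ^ m.+1)%N%:Z); first by rewrite dvdzE /= dvdn_exp.
  by rewrite -eqz_mod_dvd modz_mod.
by rewrite -eqz_mod_dvd; apply/eqP.
Qed.

Section Construction.
Variable q : padic p.
Hypothesis Uq : U 1 q.

Definition iota_red z n : int :=
  ((\sum_(i < `|red z n|%N) red q n ^+ i) %% (p ^ n)%N%:Z)%Z.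

Lemma iota_coh z n : iota_red z n = (iota_red z n.+1 %% (p ^ n)%N%:Z)%Z.
Proof.
rewrite /iota_red modz_expS; case: n => [|n]; first by rewrite expn0 !modz1.
have -> : `|red z n.+1|%N = (`|red z n.+2| %% p ^ n.+1)%N.
  by apply/eqP; rewrite -eqz_nat -modz_nat !red_absz -redP.
rewrite -geo_sum_modn ?U1_red //.
elim: `|red z n.+2|%N => [|a IHa]; first by rewrite !big_ord0.
by rewrite !big_ord_recr -modzDm IHa [red q n.+1]redP modzXm modzDm.
Qed.

Lemma iota_spec_ex : iota_spec q (fun z => Padic (iota_coh z)).
Proof.
split=> [z | k].
  move=> A; rewrite -nbhs_entourageE => -[B [n hB] hBA].
  change (nbhs z ((fun z => Padic (iota_coh z)) @^-1` A)).
  rewrite -nbhs_entourageE; exists [set xy | red xy.1 n = red xy.2 n]; first by exists n.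
  move=> y /xsectionP e; apply: hBA; apply/xsectionP; apply: hB.
  by rewrite /= /iota_red (e : red z n = red y n).
apply: padic_ext => n; rewrite padic_red_sum /= /iota_red.
case: n => [|n]; first by rewrite expn0 !modz1.
rewrite [RHS](geo_sum_modn n.+1) ?U1_red //; congr (_ %% _)%Z.
by rewrite padic_natE modz_nat absz_nat.
Qed.

End Construction.

Lemma iota_specP q : U 1 q -> iota_spec q (iota_q q).
Proof. by move=> Uq; apply: xgetPex; eexists; exact: (iota_spec_ex Uq). Qed.

Lemma continuous_padicP (f : padic p -> padic p) : continuous f -> forall z n,
  exists m, forall y, red z m = red y m -> red (f z) n = red (f y) n.
Proof.
move=> cf z n.
have : nbhs (f z) [set y | red (f z) n = red y n].
  rewrite -nbhs_entourageE; exists [set xy | red xy.1 n = red xy.2 n]; first by exists n.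
  by move=> y /xsectionP.
move=> /cf; rewrite /nbhs /= -[X in X -> _]/(nbhs z _) -nbhs_entourageE.
move=> [B [m hB] hBA]; exists m => y e; apply: (hBA y); apply/xsectionP.
exact: hB.
Qed.

Lemma iota_unique q f : U 1 q -> iota_spec q f -> f = iota_q q.
Proof.
move=> Uq [cf kf]; have [cg kg] := iota_specP Uq.
apply: funext => z; apply: padic_ext => n.
have [a ha] := continuous_padicP cf z n.
have [b hb] := continuous_padicP cg z n.
pose m := maxn a b; pose k : padic p := `|red z m|%N%:R.
have e : red z m = red k m by rewrite /k padic_natE red_absz red_mod.
rewrite (ha k) ?(hb k) /k ?kf ?kg //; apply: red_le e; rewrite ?leq_maxl ?leq_maxr //.
Qed.

(* The number of fixed points is not eventually constant for q = 1, where
   iota_q is the identity.                                                    *)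
Lemma nfix1 n : nfix (1 : padic p) n = (p ^ n)%N.
Proof.
have U1 : U 1 (1 : padic p) by exists 0; rewrite mulr0 addr0.
have i1 : id = iota_q (1 : padic p).
  apply: iota_unique => //; split=> [z A //|k].
  under eq_bigr do rewrite expr1n.
  by rewrite sumr_const card_ord.
rewrite -[RHS]card_ord /nfix; apply: eq_card => c; rewrite !inE; apply/asboolP.
exists (c : nat)%:R; first by rewrite /fixed_mod -i1.
by rewrite padic_natE modz_nat modn_small.
Qed.

End Iota.

(* Main.v *)
Require Import Defs.
From mathcomp Require Import all_boot all_order all_algebra.
From mathcomp Require Import all_classical all_reals topology.
From mathcomp Require Import ring zify.
Import Order.TTheory GRing.Theory Num.Theory.
Local Open Scope classical_set_scope.
Local Open Scope ring_scope.

(** Only z = 0, 1, 2, ... matter for the count, and for q = 1 + r and c a natural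
    number the binomial formula gives
      2 (iota_q c - c) = r c (c - 1) g(c),
    g(c) = sum_(k >= 2) (2 r^(k-2) / k!) (c-2)(c-3)...(c-k+1).
    By Legendre's bound on v_p(k!), the terms k >= 4 are divisible by p (when
    4 divides r if p = 2), and so is the term k = 3 unless p = 3 and v(r) = 1.
    Outside this case g is a unit, so 0 and 1 are the only roots of iota_q - id
    and are simple; a simple root contributes p^v classes for all large n, where
    v is the valuation of the derivative there.  If p = 2 and q = 3 mod 4, writing z = 2w or 2w + 1
    and using iota_q (2w) = (1 + q) iota_(q^2) w shows the same.
    If p = 3 and r = 3u with u a unit, g is an isometry, hence has a unique
    root a, and a = 1 or a = 0 mod 3 according to u mod 3.  The number of fixed
    points is unbounded exactly when a is one of the roots 0, 1, i.e. when
    there is no nontrivial fixed point.  For a fixed residue of u mod 3, the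
    map u |-> g(a) is an isometry as well, so such a q is unique. *)

Set Implicit Arguments.
Unset Strict Implicit.
Unset Printing Implicit Defensive.

(** * Divisibility by powers of p in Z_p *)

Section Divisibility.
Variable p : nat.
Hypothesis p_pr : prime p.
Implicit Types (q x y z w : padic p) (n m k : nat).

Local Notation P n := ((p ^ n)%N%:Z).

Let p_gt0 : (0 < p)%N := prime_gt0 p_pr.

(** Membership in p^n Z_p, as a boolean so that it can be counted. Letting n vary, it encodes the
    valuation of x without excluding x = 0. *)
Definition pdvd n x := red x n == 0.

Lemma pexpz_gt0 n : 0 < P n. Proof. by rewrite ltz_nat expn_gt0 p_gt0. Qed.

Lemma red_trunc x n m : (n <= m)%N -> (red x m %% P n)%Z = red x n.
Proof.
move=> /subnKC <-; elim: (m - n)%N => [|k IHk]; first by rewrite addn0 red_mod.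
rewrite -IHk addnS [in RHS]redP; apply/eqP; rewrite eqz_mod_dvd.
apply: (@dvdz_trans (P (n + k))); first by rewrite dvdzE /= dvdn_exp2l ?leq_addr.
by rewrite -eqz_mod_dvd modz_mod.
Qed.

Lemma pdvdE x n m : (n <= m)%N -> pdvd n x = (P n %| red x m)%Z.
Proof. by move=> nm; rewrite /pdvd -(red_trunc x nm); apply/eqP/dvdz_mod0P. Qed.

Lemma red_eqP x y n : reflect (red x n = red y n) (pdvd n (x - y)).
Proof.
rewrite (@pdvdE _ n n) //=.
have -> : (P n %| (red x n + (- red y n %% P n)%Z) %% P n)%Z
   = (P n %| red x n - red y n)%Z.
  by apply/dvdz_mod0P/dvdz_mod0P; rewrite modz_mod modzDmr.
by rewrite -eqz_mod_dvd !red_mod; apply: eqP.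
Qed.

Lemma pdvd0 n : pdvd n 0. Proof. by rewrite /pdvd /= mod0z. Qed.

Lemma pdvd_lvl0 x : pdvd 0 x.
Proof. by rewrite (@pdvdE _ 0 0) // expn0 dvd1z. Qed.

Lemma pdvd_leq n m x : (n <= m)%N -> pdvd m x -> pdvd n x.
Proof.
move=> nm; rewrite (pdvdE _ nm) => /eqP ->; exact: dvdz0.
Qed.

Lemma pdvdD n x y : pdvd n x -> pdvd n y -> pdvd n (x + y).
Proof. by rewrite /pdvd /= => /eqP -> /eqP ->; rewrite addr0 mod0z. Qed.

Lemma pdvdN n x : pdvd n (- x) = pdvd n x.
Proof.
have H y : pdvd n y -> pdvd n (- y).
  by rewrite /pdvd /= => /eqP ->; rewrite oppr0 mod0z.
by apply/idP/idP => /H //; rewrite opprK.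
Qed.

Lemma pdvdB n x y : pdvd n x -> pdvd n y -> pdvd n (x - y).
Proof. by move=> hx hy; rewrite pdvdD ?pdvdN. Qed.

Lemma pdvdMl n x y : pdvd n y -> pdvd n (x * y).
Proof. by rewrite /pdvd /= => /eqP ->; rewrite mulr0 mod0z. Qed.

Lemma pdvdMr n x y : pdvd n x -> pdvd n (x * y).
Proof. by rewrite mulrC; apply: pdvdMl. Qed.

Lemma pdvdDr n x y : pdvd n y -> pdvd n (x + y) = pdvd n x.
Proof.
move=> hy; apply/idP/idP => [h|/pdvdD]; last exact.
by rewrite -(addrK y x) pdvdB.
Qed.

Lemma pdvd_eq0 x : (forall n, pdvd n x) -> x = 0.
Proof. by move=> h; apply: padic_ext => n; rewrite /= mod0z; apply/eqP/h. Qed.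

Lemma pdvd_nat n k : pdvd n (k%:R : padic p) = (p ^ n %| k)%N.
Proof. by rewrite /pdvd padic_natE modz_nat. Qed.

Lemma pdvd_pX n m x : pdvd (n + m) (p%:R ^+ m * x) = pdvd n x.
Proof.
rewrite (pdvdE _ (leqnn _)) (@pdvdE x n (n + m)) ?leq_addr //.
rewrite -natrX padic_redM padic_natE modzMml.
have -> (a : int) : (P (n + m) %| (a %% P (n + m))%Z)%Z = (P (n + m) %| a)%Z.
  by apply/dvdz_mod0P/dvdz_mod0P; rewrite modz_mod.
by rewrite expnD mulnC PoszM dvdz_mul2l // gt_eqF ?pexpz_gt0.
Qed.

Lemma pdvdP n x : pdvd n x <-> exists c, x = p%:R ^+ n * c.
Proof.
split=> [h|[c ->]]; last by rewrite -[n in pdvd n _]add0n pdvd_pX pdvd_lvl0.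
have dx m : (P n %| red x (m + n))%Z by rewrite -pdvdE ?leq_addl.
(* Division by p^n shifts levels: the quotient modulo p^m is read off from x modulo p^(m+n). *)
have coh m : (red x (m + n) %/ P n)%Z =
    ((red x (m.+1 + n) %/ P n)%Z %% P m)%Z.
  apply: (@mulfI _ (P n)); first by rewrite gt_eqF ?pexpz_gt0.
  rewrite mulz_modr ?pexpz_gt0 // ![P n * _]mulrC !divzK //.
  by rewrite -PoszM -expnD red_trunc // leq_add2r.
exists (Padic coh); apply: padic_ext => m.
rewrite -natrX padic_redM padic_natE modzMml /= mulrC divzK //.
by rewrite red_trunc // leq_addr.
Qed.

Lemma coprime_red w n m : ~~ pdvd 1 w -> (0 < m)%N -> coprimez (P n) (red w m).
Proof.
move=> hw m0; rewrite coprimezE; apply: coprimeXl.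
by move: hw; rewrite (pdvdE _ m0) expn1 dvdzE /= -prime_coprime.
Qed.

Lemma pdvd_unitM n w x : ~~ pdvd 1 w -> pdvd n (w * x) = pdvd n x.
Proof.
case: n => [|n] hw; first by rewrite !pdvd_lvl0.
rewrite !(pdvdE _ (leqnn n.+1)) padic_redM.
have -> (a : int) : (P n.+1 %| (a %% P n.+1)%Z)%Z = (P n.+1 %| a)%Z.
  by apply/dvdz_mod0P/dvdz_mod0P; rewrite modz_mod.
by rewrite Gauss_dvdzr // coprime_red.
Qed.

(** Bezout gives an inverse modulo each p^n; these cohere because an inverse modulo p^n is
    unique. *)
Lemma padic_unit_inv w : ~~ pdvd 1 w -> exists y, w * y = 1.
Proof.
move=> hw.
have inv n : exists y : int, (red w n.+1 * y = 1 %[mod P n])%Z.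
  have /coprimezP[[u v] /= huv] := coprime_red n hw (ltn0Sn n).
  exists v; have -> : red w n.+1 * v = - u * P n + 1 by rewrite -huv; ring.
  by rewrite modzMDl.
have [y hy] := boolp.choice inv.
have coh n : (y n %% P n)%Z = ((y n.+1 %% P n.+1)%Z %% P n)%Z.
  rewrite modz_expS; apply/eqP; rewrite eqz_mod_dvd.
  rewrite -(Gauss_dvdzr _ (coprime_red n hw (ltn0Sn n))) mulrBr -eqz_mod_dvd hy.
  rewrite eq_sym -modzMml -(red_trunc w (leqnSn n.+1)).
  rewrite modz_expS modzMml eqz_mod_dvd.
  apply: (@dvdz_trans (P n.+1)); first by rewrite dvdzE /= dvdn_exp2l.
  by rewrite -eqz_mod_dvd; apply/eqP.
exists (Padic coh); apply: padic_ext => n.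
rewrite padic_redM /= modzMmr -hy; apply/eqP; rewrite -(red_trunc w (leqnSn n)).
by rewrite modzMml.
Qed.

Lemma padic_decomp x : x <> 0 -> exists a w, x = p%:R ^+ a * w /\ ~~ pdvd 1 w.
Proof.
move=> x0; have ex : exists n, ~~ pdvd n x.
  by apply: contra_notP x0 => h; apply: pdvd_eq0 => n; apply: contra_notT h; exists n.
case: (ex_minnP ex) => -[|a]; first by rewrite pdvd_lvl0.
move=> ha amin; have : pdvd a x by apply/negP => /negP /amin; rewrite ltnn.
move=> /pdvdP[w xE]; exists a, w; split=> //.
by apply: contra ha; rewrite xE -[a.+1]add1n pdvd_pX.
Qed.

(** Additivity of valuations: i is the minimum of n and v(x), which is n when x = 0. *)
Lemma pdvdM_split n x y : pdvd n (x * y) ->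
  exists i, [/\ (i <= n)%N, pdvd i x & pdvd (n - i) y].
Proof.
have [->|/padic_decomp [a [w [-> hw]]]] := pselect (x = 0).
  by exists n; rewrite leqnn subnn pdvd0 pdvd_lvl0.
have ha : pdvd a (p%:R ^+ a * w) by rewrite -[a in pdvd a _]add0n pdvd_pX pdvd_lvl0.
have [na h|an] := leqP n a.
  by exists n; rewrite leqnn subnn pdvd_lvl0 (pdvd_leq na).
rewrite -mulrA -{1}(subnK (ltnW an)) pdvd_pX pdvd_unitM // => hy.
by exists a; rewrite (ltnW an).
Qed.

Lemma pdvd_pXM n m x : pdvd n (p%:R ^+ m * x) = pdvd (n - m) x.
Proof.
have [nm|mn] := leqP n m; last by rewrite -{1}(subnK (ltnW mn)) pdvd_pX.
move: (nm) => /eqP ->; rewrite pdvd_lvl0; apply: (pdvd_leq nm).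
by rewrite -[m in pdvd m _]add0n pdvd_pX pdvd_lvl0.
Qed.

End Divisibility.

(** * Fixed points modulo p^n as residue classes of natural numbers *)

Section Residues.
Variable p : nat.
Hypothesis p_pr : prime p.
Implicit Types (q x y z w : padic p) (n m k c : nat).

Let p_gt0 : (0 < p)%N := prime_gt0 p_pr.

Definition excess q c : padic p := \sum_(i < c) q ^+ i - c%:R.

(** By uniqueness [iota_q] is the explicit construction, whose level n is computed from [red z n]
    alone. *)
Lemma iota_congr q z z' n : U 1 q -> red z n = red z' n ->
  red (iota_q q z) n = red (iota_q q z') n.
Proof.
move=> Uq e; rewrite -(iota_unique p_gt0 Uq (iota_spec_ex p_gt0 Uq)) /=.
by rewrite /iota_red e.
Qed.

Lemma red_nat_absz z n : red z n = red (`|red z n|%N%:R : padic p) n.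
Proof. by rewrite padic_natE red_absz // red_mod. Qed.

Lemma fixed_modE q z n c : U 1 q -> red z n = red (c%:R : padic p) n ->
  fixed_mod q n z <-> pdvd n (excess q c).
Proof.
move=> Uq e; rewrite /fixed_mod (iota_congr Uq e) e.
rewrite (iota_specP p_gt0 Uq).2; by split=> [h|/red_eqP //]; apply/red_eqP.
Qed.

Lemma nat_red_modn n c d : (c = d %[mod p ^ n])%N ->
  red (c%:R : padic p) n = red (d%:R : padic p) n.
Proof. by rewrite !padic_natE !modz_nat => ->. Qed.

Lemma excess_modn q n c d : U 1 q -> (c = d %[mod p ^ n])%N ->
  pdvd n (excess q c) = pdvd n (excess q d).
Proof.
move=> Uq /nat_red_modn e; apply/idP/idP.
  by move/(fixed_modE Uq (erefl _)) => /(fixed_modE Uq e).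
by move/(fixed_modE Uq e) => /(fixed_modE Uq (erefl _)).
Qed.

Lemma nfixE q n : U 1 q ->
  nfix q n = #|[pred c : 'I_(p ^ n) | pdvd n (excess q c)]|.
Proof.
move=> Uq; apply: eq_card => c; rewrite !inE.
have cE : red (c%:R : padic p) n = c.
  by rewrite padic_natE modz_nat modn_small.
apply/asboolP/idP => [[z fz zc]|].
  have e : red z n = red (c%:R : padic p) n by rewrite zc cE.
  exact: (fixed_modE Uq e).1.
by exists c%:R => //; apply/(fixed_modE Uq (erefl _)).
Qed.

Lemma card_class n m d : (m <= n)%N -> (d < p ^ m)%N ->
  #|[pred c : 'I_(p ^ n) | c == d %[mod p ^ m]]| = (p ^ (n - m))%N.
Proof.
move=> mn hd; have pn : (p ^ n = p ^ (n - m) * p ^ m)%N by rewrite -expnD subnK.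
have lt (i : 'I_(p ^ (n - m))) : (i * p ^ m + d < p ^ n)%N.
  apply: (@leq_trans (i.+1 * p ^ m)); first by rewrite mulSnr ltn_add2l.
  by rewrite pn leq_mul2r ltn_ord orbT.
have pm0 : (0 < p ^ m)%N by rewrite expn_gt0 p_gt0.
rewrite -[RHS]card_ord -(card_imset predT (f := fun i => Ordinal (lt i))); last first.
  move=> i j /(congr1 val) /= /eqP; rewrite eqn_add2r eqn_pmul2r // => /eqP.
  exact: val_inj.
apply: eq_card => c; rewrite inE; apply/eqP/imsetP => [e|[i _ ->]] /=; last first.
  by rewrite modnMDl.
have cd : (c %/ p ^ m < p ^ (n - m))%N by rewrite ltn_divLR // -pn.
exists (Ordinal cd) => //; apply: val_inj => /=.
by rewrite {1}(divn_eq c (p ^ m)) e modn_small.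
Qed.

Lemma pdvd_subnat n x c : pdvd n (c%:R - x) = (c == `|red x n|%N %[mod p ^ n]).
Proof.
apply/red_eqP/eqP => [|e].
  rewrite padic_natE modz_nat [in RHS]red_nat_absz padic_natE modz_nat => -[].
  exact.
by rewrite [RHS]red_nat_absz !padic_natE !modz_nat e.
Qed.

(** An injective map from the p^n residues to themselves is onto, so 0 is attained. This counting
    replaces Hensel's lemma in finding the root of g. *)
Lemma pdvd_inj_surj (G : nat -> padic p) n :
  (forall i j, pdvd n (G i - G j) -> (i = j %[mod p ^ n])%N) ->
  exists i, pdvd n (G i).
Proof.
move=> Ginj; have pn0 : (0 < p ^ n)%N by rewrite expn_gt0 p_gt0.
pose f (i : 'I_(p ^ n)) : 'I_(p ^ n) := Ordinal (ltn_pmod `|red (G i) n| pn0).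
have finj : injective f.
  move=> i j /(congr1 val) /= e; apply: val_inj => /=.
  rewrite -(modn_small (ltn_ord i)) -(modn_small (ltn_ord j)); apply: Ginj.
  by apply/red_eqP; rewrite red_nat_absz [RHS]red_nat_absz; apply: nat_red_modn.
have [g _ fg] := injF_bij finj; exists (g (Ordinal pn0)).
have /= h0 := congr1 val (fg (Ordinal pn0)).
by rewrite /pdvd red_nat_absz padic_natE modz_nat h0.
Qed.

Lemma card_pdvd n m x : (m <= n)%N ->
  #|[pred c : 'I_(p ^ n) | pdvd m (c%:R - x)]| = (p ^ (n - m))%N.
Proof.
move=> mn; rewrite -(@card_class n m (`|red x m| %% p ^ m)) //; last first.
  by rewrite ltn_mod expn_gt0 p_gt0.
by apply: eq_card => c; rewrite !inE pdvd_subnat modn_mod.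
Qed.

Lemma U_pdvdP m q : U m q <-> pdvd m (q - 1).
Proof.
split=> [[c ->]|/(pdvdP p_pr)[c qc]]; last by exists c; rewrite -qc addrCA subrr addr0.
by rewrite addrAC subrr add0r; apply/(pdvdP p_pr); exists c.
Qed.

End Residues.

(** * The binomial expansion of iota_q *)

Section LogFactorial.
Variable p : nat.
Hypothesis p_pr : prime p.

(** Induction from p floor(k / p^(J+1)) <= floor(k / p^J). The extra quotient on the left later
    makes the bound strict. *)
Lemma sum_divX_le k J :
  (p.-1 * (\sum_(1 <= j < J.+1) k %/ p ^ j) + k %/ p ^ J <= k)%N.
Proof.
elim: J => [|J IHJ]; first by rewrite big_geq // muln0 expn0 divn1.
apply: leq_trans IHJ; rewrite big_nat_recr //= mulnDr -addnA leq_add2l.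
rewrite -mulSnr prednK ?prime_gt0 // expnSr divnMA mulnC; exact: leq_divM.
Qed.

Lemma logn_fact_lt k : (0 < k)%N -> (p.-1 * logn p k`! < k)%N.
Proof.
move=> k0; have p1 := prime_gt1 p_pr; rewrite logn_fact //.
have /andP[tl tu] := trunc_log_bounds p1 k0; set t := trunc_log p k in tl tu.
have tk : (t <= k)%N by rewrite (leq_trans _ tl) // ltnW // ltn_expl.
(* As p^t <= k < p^(t+1), the terms of Legendre's formula beyond t vanish, and floor(k / p^t) >=
   1. *)
rewrite (@big_cat_nat _ _ _ t.+1) //= [X in (_ + X)%N]big1_seq ?addn0; last first.
  move=> j /andP[_]; rewrite mem_index_iota => /andP[tj _].
  by rewrite divn_small // (leq_trans tu) // leq_exp2l.
apply: leq_trans (sum_divX_le k t); rewrite -addn1 leq_add2l.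
by rewrite divn_gt0 // expn_gt0 prime_gt0.
Qed.

(** With k! = m p^v and m prime to p, the witness is p^(e-v-1) / m. *)
Lemma padic_div_fact k e : (logn p k`! < e)%N ->
  exists d : padic p, k`!%:R * (p%:R * d) = p%:R ^+ e.
Proof.
move=> ke; have [m pm kE] := pfactor_coprime p_pr (fact_gt0 k).
have /(padic_unit_inv p_pr)[y my] : ~~ pdvd 1 (m%:R : padic p).
  by rewrite pdvd_nat // expn1 -prime_coprime.
exists (p%:R ^+ (e - (logn p k`!).+1) * y).
rewrite {1}kE natrM natrX -[X in _ = _ ^+ X](subnK ke) exprD exprS.
move: my; move: (m%:R : padic p) (p%:R : padic p) => m' p' my.
rewrite -[RHS]mulr1 -my.
by move: (p' ^+ _) (p' ^+ _) => A B; ring.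
Qed.

End LogFactorial.

Section Expansion.

(** Induction on c by Pascal's rule. The terms k >= c vanish, so N can be any bound on c. *)
Lemma geo_sum_binomial (R : comPzRingType) (r : R) c N : (c <= N)%N ->
  \sum_(i < c) (1 + r) ^+ i = \sum_(k < N) 'C(c, k.+1)%:R * r ^+ k.
Proof.
have pw d : (d < N)%N -> (1 + r) ^+ d = \sum_(k < N) 'C(d, k)%:R * r ^+ k.
  move=> dN; rewrite exprDn [RHS](bigID (fun k : 'I_N => (k < d.+1)%N)) /=.
  rewrite [X in _ = _ + X]big1 ?addr0; last first.
    by move=> k; rewrite -leqNgt => dk; rewrite bin_small // mul0r.
  rewrite -(big_ord_widen N (fun k => 'C(d, k)%:R * r ^+ k) dN).
  by apply: eq_bigr => k _; rewrite expr1n mul1r mulr_natl.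
elim: c => [|c IHc] cN.
  by rewrite big_ord0 big1 // => k _; rewrite bin0n mul0r.
rewrite big_ord_recr /= IHc ?(ltnW cN) // pw // -big_split /=.
by apply: eq_bigr => k _; rewrite -mulrDl -natrD -binS.
Qed.

Variable p : nat.
Hypothesis p_pr : prime p.
Implicit Types (x y u d : padic p) (e : nat -> padic p) (c j N : nat).

(* (x - 2)(x - 3)...(x - j - 1), so that x (x - 1) fall2 x j is the falling
   factorial of length j + 2. *)
Definition fall2 x j : padic p := \prod_(i < j) (x - i.+2%:R).

Lemma ffact_fall2 c j :
  (c ^_ j.+2)%:R = c%:R * (c%:R - 1) * fall2 c%:R j :> padic p.
Proof.
have sub1 k m : ((k ^_ m) * (k - m))%:R = (k ^_ m)%:R * (k%:R - m%:R) :> padic p.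
  have [mk|km] := leqP m k; first by rewrite natrM natrB.
  by rewrite ffact_small // mul0n mul0r.
elim: j => [|j IHj]; last first.
  by rewrite ffactnSr sub1 IHj /fall2 big_ord_recr /= mulrA.
by rewrite ffactnSr sub1 ffactn1 /fall2 big_ord0 mulr1.
Qed.

(* The partial sums of g: d is the coefficient base / 3 of k = 3, and p (e j)
   is the coefficient 2 base^(j+2) / (j+4)! of k = j + 4, where r = base u. *)
Definition cofactor_series d e N u x : padic p :=
  1 + d * u * (x - 2%:R) + p%:R * \sum_(j < N) e j * u ^+ j.+2 * fall2 x j.+2.

Definition base : nat := if p == 2%N then 4%N else p.

(* d and e do not depend on u: this is what allows comparing two values of q. *)
Lemma excess_expansion : exists (d : padic p) (e : nat -> padic p),
  [/\ p = 3%N -> d = 1, p != 3%N -> exists d', d = p%:R * d' &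
   forall u c N, (c <= N)%N -> 2%:R * excess (1 + base%:R * u) c =
     base%:R * u * (c%:R * (c%:R - 1)) * cofactor_series d e N u c%:R].
Proof.
have p1 := prime_gt1 p_pr.
have [d [d3 dp db]] : exists d : padic p, [/\ p = 3%N -> d = 1,
    p != 3%N -> exists d', d = p%:R * d' & 3%:R * d = base%:R].
  have [p3|p3] := eqVneq p 3%N.
    exists 1; rewrite mulr1 /base p3; split=> //.
  have /(padic_unit_inv p_pr)[y y3] : ~~ pdvd 1 (3%:R : padic p).
    by rewrite pdvd_nat // expn1 dvdn_prime2.
  exists (base%:R * y); split; last by rewrite mulrCA y3 mulr1.
    by move=> p3'; rewrite p3' in p3.
  move=> _; rewrite /base; have [p2|_] := eqVneq p 2%N; last by exists y.
  exists (2%:R * y); rewrite mulrA; congr (_ * y).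
  by rewrite (congr1 (fun k => k%:R : padic p) p2) -natrM.
(* For p = 2 the right side is 2^(2j+5), while v((j+4)!) < j + 4. For odd p, 2 v((j+4)!) < j + 4
   gives v((j+4)!) < j + 2. Either way a factor p is left over. *)
have coef j : exists w : padic p,
    (j + 4)`!%:R * (p%:R * w) = 2%:R * base%:R ^+ j.+2.
  have := @logn_fact_lt p p_pr (j + 4) (ltn_addl j (ltn0Sn 3)).
  rewrite /base; have [p2|p2] := eqVneq p 2%N => hl.
    have [|w hw] := @padic_div_fact p p_pr (j + 4) (j.+2 * 2).+1.
      by move: hl; rewrite {1}p2 /=; lia.
    exists w; rewrite hw exprS mulnC exprM.
    by rewrite (congr1 (fun k => k%:R : padic p) p2) -natrX.
  have [|w hw] := @padic_div_fact p p_pr (j + 4) j.+2.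
    have : (2 <= p.-1)%N by lia.
    by move=> /(leq_mul)/(_ (leqnn (logn p (j + 4)`!))); lia.
  by exists (2%:R * w); rewrite -hw; ring.
have [e he] := boolp.choice coef.
exists d, e; split=> // u c N cN.
(* Three leading terms, with binomials C(c,1), C(c,2) and C(c,3), are split off, leaving N; the
   first one cancels against the c in [excess]. *)
have cN3 : (c <= N.+3)%N by rewrite (leq_trans cN) // -addn3 leq_addr.
rewrite /excess (geo_sum_binomial _ cN3) 3!big_ord_recl.
have binE k : 'C(c, k.+2)%:R * (k.+2)`!%:R =
    c%:R * (c%:R - 1) * fall2 c%:R k :> padic p.
  by rewrite -natrM bin_ffact ffact_fall2.
have bin2' : 'C(c, 2)%:R * 2%:R = c%:R * (c%:R - 1) :> padic p.
  by rewrite (binE 0%N) /fall2 big_ord0 mulr1.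
have bin3' : 'C(c, 3)%:R * 6%:R = c%:R * (c%:R - 1) * (c%:R - 2%:R) :> padic p.
  by rewrite (binE 1%N) /fall2 big_ord1.
pose T j := 'C(c, j.+4)%:R * (base%:R * u) ^+ j.+3.
have tailE : 2%:R * (\sum_(j < N) T j) = base%:R * u * (c%:R * (c%:R - 1)) *
    (p%:R * \sum_(j < N) e j * u ^+ j.+2 * fall2 c%:R j.+2).
  rewrite !mulr_sumr; apply: eq_bigr => j _; rewrite /T exprS exprMn.
  have hf := he j; rewrite addn4 in hf.
  have aux (f C F V B b v A w z : padic p) : f * (w * z) = 2%:R * B -> C * f = A * F ->
      2%:R * (C * (b * v * (B * V))) = b * v * A * (w * (z * V * F)).
    move=> h1 h2; transitivity (b * v * V * C * (2%:R * B)); first by ring.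
    by rewrite -h1; transitivity (b * v * V * (C * f) * (w * z)); [ring|rewrite h2; ring].
  exact: aux hf (binE j.+2).
have -> : \sum_(i < N) 'C(c, (lift ord0 (lift ord0 (lift ord0 i))).+1)%:R *
        (base%:R * u) ^+ lift ord0 (lift ord0 (lift ord0 i)) = \sum_(j < N) T j.
  by apply: eq_bigr.
rewrite /cofactor_series [RHS]mulrDr -tailE {tailE}; move: (\sum_(j < N) T j) => S.
rewrite -[X in X = _]/(2%:R * ('C(c, 1)%:R * (base%:R * u) ^+ 0 +
  ('C(c, 2)%:R * (base%:R * u) ^+ 1 + ('C(c, 3)%:R * (base%:R * u) ^+ 2 + S)) - c%:R)).
rewrite bin1 expr0 expr1.
move: bin2' bin3' db.
move: ('C(c, 2)%:R : padic p) ('C(c, 3)%:R : padic p) => C2 C3 h2 h3 h4.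
transitivity (2%:R * S + base%:R * u * (C2 * 2%:R + 2%:R * C3 * (u * base%:R)));
  first by ring.
rewrite -h4 h2.
transitivity (2%:R * S +
  3%:R * d * u * (c%:R * (c%:R - 1) + u * d * (C3 * 6%:R))); first by ring.
by rewrite h3; ring.
Qed.

End Expansion.

(** * Counting residue classes near simple roots *)

Section Roots.
Variable p : nat.
Hypothesis p_pr : prime p.
Implicit Types (q x y z w c : padic p) (n m a b N : nat).

Lemma padic_mulf_eq0 x y : x * y = 0 -> x = 0 \/ y = 0.
Proof.
have [->|/padic_decomp [//|a [w [-> hw]]]] := pselect (x = 0); first by left.
rewrite -mulrA => xy0; right; apply: pdvd_eq0 => n.
by rewrite -(pdvd_unitM p_pr _ _ hw) -(pdvd_pX p_pr _ a) xy0 pdvd0.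
Qed.

(** A splitting p^i | x, p^(m-i) | y with 0 < i < m would make p divide both factors. *)
Lemma pdvdM_coprime m x y : ~~ (pdvd 1 x && pdvd 1 y) ->
  pdvd m (x * y) = pdvd m x || pdvd m y.
Proof.
move=> hxy; apply/idP/orP => [/(pdvdM_split p_pr)[i [im hx hy]]|]; last first.
  by case; [apply: pdvdMr | apply: pdvdMl].
case: i => [|i] in im hx hy *; first by right; rewrite subn0 in hy.
left; move: hxy; rewrite (pdvd_leq _ hx) //=.
case: (ltngtP i.+1 m) im => // [im _|<- _ _ //].
by rewrite (pdvd_leq _ hy) // subn_gt0.
Qed.

(* b is the valuation of y - x: a point close to one root is at distance
   exactly p^(-b) from the other one. *)
Lemma pdvd_close_roots m b c x y w : (b.*2 < m)%N -> y - x = p%:R ^+ b * w ->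
  ~~ pdvd 1 w ->
  pdvd m ((c - x) * (c - y)) = pdvd (m - b) (c - x) || pdvd (m - b) (c - y).
Proof.
move=> bm xy hw; have yx : x - y = p%:R ^+ b * - w by rewrite mulrN -xy opprB.
have close z v : pdvd (m - b) z -> pdvd m (z * (z + p%:R ^+ b * v)).
  move=> hz; have /(pdvdP p_pr)[s ->] := hz.
  have -> : (p%:R ^+ (m - b) * s + p%:R ^+ b * v : padic p) =
      p%:R ^+ b * (p%:R ^+ (m - b - b) * s + v).
    by rewrite mulrDr mulrA -exprD subnKC //; lia.
  have mb : (m = m - b + b)%N by lia.
  rewrite {1}mb mulrCA pdvd_pX // -mulrA.
  by apply/(pdvdP p_pr); exists (s * (p%:R ^+ (m - b - b) * s + v)).
apply/idP/orP => [/(pdvdM_split p_pr)[i [im hX hY]]|[] h].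
- have [ib|bi] := leqP i b; first by right; apply: pdvd_leq hY => //; lia.
  have [mib|bmi] := leqP (m - i) b; first by left; apply: pdvd_leq hX => //; lia.
  have : pdvd b.+1 (y - x).
    rewrite (_ : y - x = (c - x) - (c - y)); last by ring.
    by rewrite pdvdB // ?(pdvd_leq bi hX) // (pdvd_leq bmi hY).
  by rewrite xy pdvd_pXM // subSnn (negbTE hw).
- suff -> : c - y = c - x + p%:R ^+ b * - w by apply: close.
  by rewrite -yx; ring.
- suff -> : c - x = c - y + p%:R ^+ b * w by rewrite mulrC; apply: close.
  by rewrite -xy; ring.
Qed.

(** An entry (a, x) of [s] stands for a simple root x of [iota_q] - id whose derivative has
    valuation a: modulo p^n it is smeared out over p^a classes. *)
Notation near_root n s z := (has (fun ax => pdvd (n - ax.1) (z - ax.2)) s).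

Lemma near_root_disjoint a x (s : seq (nat * padic p)) : x \notin map snd s ->
  exists N, forall n z, (N <= n)%N -> pdvd (n - a) (z - x) -> ~~ near_root n s z.
Proof.
elim: s => [|[b y] s IHs] /=; first by exists 0%N.
rewrite inE negb_or => /andP[/eqP xy /IHs[N hN]].
have [k [w [yx hw]]] := padic_decomp p_pr (contra_not (fun e => subr0_eq e) xy).
(* Here k = v(x - y): once n - a and n - b exceed k, no z is that close to both x and y. *)
exists (N + a + b + k.+1)%N => n z nN hz; rewrite negb_or hN ?andbT //; last by lia.
apply/negP => hzy; have : pdvd k.+1 (x - y).
  rewrite (_ : x - y = (z - y) - (z - x)); last by ring.
  by rewrite pdvdB //; [apply: pdvd_leq hzy|apply: pdvd_leq hz] => //; lia.
by rewrite yx pdvd_pXM // subSnn (negbTE hw).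
Qed.

Lemma card_near_root (s : seq (nat * padic p)) : uniq (map snd s) ->
  exists N, forall n, (N <= n)%N ->
    #|[pred c : 'I_(p ^ n) | near_root n s c%:R]| = (\sum_(ax <- s) p ^ ax.1)%N.
Proof.
elim: s => [|[a x] s IHs] /=.
  by exists 0%N => n _; rewrite big_nil eq_card0.
move=> /andP[/(near_root_disjoint a)[N1 h1] /IHs[N2 h2]].
exists (N1 + N2 + a)%N => n nN; rewrite big_cons -(h2 n); last by lia.
have an : (a <= n)%N by lia.
have -> : (p ^ a)%N = #|[pred c : 'I_(p ^ n) | pdvd (n - a) (c%:R - x)]|.
  by rewrite card_pdvd // ?subKn // leq_subr.
rewrite -cardUI [X in (_ + X)%N]eq_card0 ?addn0; last first.
  move=> c; rewrite !inE; apply/negbTE/negP => /andP[/= h].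
  by apply/negP; apply: h1 h; lia.
by apply: eq_card => c; rewrite !inE.
Qed.

Lemma nfix_stable q (s : seq (nat * padic p)) N : U 1 q -> uniq (map snd s) ->
  (forall n (c : nat), (N <= n)%N -> pdvd n (excess q c) = near_root n s c%:R) ->
  exists k : nat, \forall n \near \oo, nfix q n = k.
Proof.
move=> Uq us hs; have [M hM] := card_near_root us.
exists (\sum_(ax <- s) p ^ ax.1)%N; exists (N + M)%N => // n /= nNM.
rewrite nfixE // -(hM n); last by lia.
by apply: eq_card => c; rewrite !inE hs //; lia.
Qed.

Lemma pdvd_1 : ~~ pdvd 1 (1 : padic p).
Proof. by rewrite (pdvd_nat p 1 1) expn1 dvdn1; case: eqP (prime_gt1 p_pr) => // ->. Qed.

Lemma padic_one_neq0 : (1 : padic p) <> 0.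
Proof. by move=> e; move: pdvd_1; rewrite e pdvd0. Qed.

(** The roots 0 and 1 differ by a unit, so p divides at most one of c and c - 1 and the product
    splits. *)
Lemma nfix_stable_trivial q a N : U 1 q ->
  (forall n (c : nat), (N <= n)%N ->
     pdvd n (excess q c) = pdvd (n - a) (c%:R * (c%:R - 1) : padic p)) ->
  exists k : nat, \forall n \near \oo, nfix q n = k.
Proof.
move=> Uq h; apply: (@nfix_stable q [:: (a, 0); (a, 1)] N) => //= [|n c nN].
  by rewrite inE andbT eq_sym; apply/eqP/padic_one_neq0.
rewrite h // pdvdM_coprime ?subr0 ?orbF //.
apply: contra pdvd_1 => /andP[h1 h2].
by rewrite -(subKr (c%:R : padic p) 1) pdvdB.
Qed.

End Roots.

(** * Stability when the cofactor g is a unit *)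

Section TrivialRoots.
Variable p : nat.
Hypothesis p_pr : prime p.
Implicit Types (q u d : padic p) (e : nat -> padic p) (n c : nat).

Lemma baseE : (base p)%:R = p%:R ^+ (p == 2%N).+1 :> padic p.
Proof.
rewrite /base; case: eqP => [p2|_]; last by rewrite expr1.
by rewrite (congr1 (fun k => k%:R : padic p) p2) -natrX.
Qed.

Lemma pdvd_2M n (x : padic p) : pdvd (n + (p == 2%N)) (2%:R * x) = pdvd n x.
Proof.
have [p2|p2] := eqVneq p 2%N; last first.
  by rewrite addn0 pdvd_unitM // pdvd_nat expn1 dvdn_prime2.
rewrite -(congr1 (fun k => k%:R : padic p) p2) -[X in X * _]expr1.
by rewrite pdvd_pX.
Qed.

(** Both trivial roots have derivative of valuation v(u) + v(base) - v(2), which is v(u) + 1 for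
    every p: the difference is 2 - 1 for p = 2 and 1 - 0 otherwise. *)
Lemma nfix_stable_unit d e u : U 1 (1 + (base p)%:R * u) -> u <> 0 ->
  (forall c, 2%:R * excess (1 + (base p)%:R * u) c =
     (base p)%:R * u * (c%:R * (c%:R - 1)) * cofactor_series d e c u c%:R) ->
  (forall c, ~~ pdvd 1 (cofactor_series d e c u c%:R)) ->
  exists k : nat, \forall n \near \oo, nfix (1 + (base p)%:R * u) n = k.
Proof.
move=> Uq /(padic_decomp p_pr)[a [w [uE hw]]] hE hu.
apply: (@nfix_stable_trivial p p_pr _ a.+1 0) => // n c _.
rewrite -pdvd_2M hE mulrC pdvd_unitM // baseE uE -mulrA -mulrA pdvd_pXM //.
by rewrite pdvd_pXM // pdvd_unitM //; congr pdvd; lia.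
Qed.

Lemma cofactor_series_unit d e N u (x : padic p) :
  pdvd 1 (d * u) -> ~~ pdvd 1 (cofactor_series d e N u x).
Proof.
move=> du; rewrite /cofactor_series -addrA pdvdDr ?pdvd_1 // pdvdD //.
  exact: pdvdMr.
by rewrite pdvdMr // pdvd_nat expn1.
Qed.

End TrivialRoots.

(** * The case p = 2 and q = 3 mod 4 *)

Section DyadicMinus.
Implicit Types (q t s : padic 2) (n w : nat).

Lemma geo_sum_double q w :
  \sum_(i < w.*2) q ^+ i = (1 + q) * \sum_(i < w) (q ^+ 2) ^+ i.
Proof.
elim: w => [|w IHw]; first by rewrite !big_ord0 mulr0.
rewrite doubleS !big_ord_recr /= IHw (exprS q w.*2) -mul2n exprM.
by move: (_ ^+ w) => X; ring.
Qed.

(** Since v(s) >= v(w), the term 2ts is negligible against w. *)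
Lemma pdvd_double_sub t s n w : (forall m, pdvd m (w%:R : padic 2) -> pdvd m s) ->
  pdvd n (2%:R * (2%:R * t * s - w%:R)) = pdvd n (2%:R * w%:R : padic 2).
Proof.
move=> ws; have -> (x : padic 2) : pdvd n (2%:R * x) = pdvd n.-1 x.
  by rewrite -[2%:R]expr1 pdvd_pXM // subn1.
have -> (x : padic 2) : pdvd n (2%:R * x) = pdvd n.-1 x.
  by rewrite -[2%:R]expr1 pdvd_pXM // subn1.
move: (n.-1) => k; apply/idP/idP => h; last by rewrite pdvdB // pdvdMl // ws.
(* Divisibility climbs one level at a time: if 2^m divides w, then 2^(m+1) divides 2ts, hence also w
   = 2ts - (2ts - w). *)
have {}h m : (m <= k)%N -> pdvd m (w%:R : padic 2).
  elim: m => [|m IHm] mk; first exact: pdvd_lvl0.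
  rewrite -(subKr (2%:R * t * s) w%:R) pdvdB //; last exact: pdvd_leq h.
  rewrite -mulrA -[2%:R]expr1 pdvd_pXM // subn1 /= pdvdMl //.
  by apply: ws; apply: IHm; apply: ltnW.
exact: h.
Qed.

(** For c = 2w or 2w + 1 the excess is 2 (2t's - w), with t' = t or qt and s the value of [iota_q]
    for q^2 at w, while c (c - 1) is 2w times a unit. *)
Lemma excess_dyadic q t n c : U 1 q -> 1 + q = 4%:R * t ->
  pdvd n (excess q c) = pdvd n (c%:R * (c%:R - 1) : padic 2).
Proof.
move=> Uq qt; set s := fun w => \sum_(i < w) (q ^+ 2) ^+ i.
have Uq2 : U 1 (q ^+ 2).
  by case: Uq => r ->; exists (2%:R * r + 2%:R * r ^+ 2); ring.
(* Modulo 2^m the value [s w] depends only on w modulo 2^m, and [s 0] is 0. *)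
have ws w m : pdvd m (w%:R : padic 2) -> pdvd m (s w).
  move=> hw; have -> : s w = excess (q ^+ 2) w + w%:R by rewrite /excess subrK.
  rewrite pdvdD // (@excess_modn _ _ _ _ _ 0) //.
    by rewrite /excess big_ord0 subr0 pdvd0.
  by apply/eqP; rewrite mod0n; move: hw; rewrite pdvd_nat.
have odd_unit w : ~~ pdvd 1 (2%:R * w%:R + 1 : padic 2).
  by rewrite addrC pdvdDr ?pdvd_1 // pdvdMr // pdvd_nat.
rewrite -(odd_double_half c); set w := c./2.
have wE : (w.*2)%:R = 2%:R * w%:R :> padic 2 by rewrite -mul2n natrM.
have wE1 : (w.*2.+1)%:R = 2%:R * w%:R + 1 :> padic 2 by rewrite -natr1 wE.
case: (odd c).
- rewrite add1n; have -> : excess q w.*2.+1 = 2%:R * (2%:R * (q * t) * s w - w%:R).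
    rewrite /excess big_ord_recl expr0 /=.
    have -> : \sum_(i < w.*2) q ^+ bump 0 i = q * \sum_(i < w.*2) q ^+ i.
      by rewrite mulr_sumr; apply: eq_bigr => i _; rewrite exprS.
    by rewrite geo_sum_double qt -/(s w) wE1; ring.
  rewrite pdvd_double_sub; last exact: ws.
  by rewrite wE1 addrK [RHS]pdvd_unitM // odd_unit.
- rewrite add0n; have -> : excess q w.*2 = 2%:R * (2%:R * t * s w - w%:R).
    by rewrite /excess geo_sum_double qt -/(s w) wE; ring.
  rewrite pdvd_double_sub; last exact: ws.
  rewrite wE [in RHS]mulrC [RHS]pdvd_unitM //.
  apply: contra (odd_unit w) => h.
  rewrite (_ : 2%:R * w%:R + 1 = 2%:R * w%:R - 1 + 2%:R :> padic 2); last by ring.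
  by rewrite pdvdD // pdvd_nat.
Qed.

End DyadicMinus.

(** * Difference quotients of the cofactor series *)

Section SeriesDifferences.
Variable p : nat.
Implicit Types (x y u v d : padic p) (e : nat -> padic p) (c j N : nat).

Lemma fall2_eq0 c j : (2 <= c)%N -> (c < j.+2)%N -> fall2 (c%:R : padic p) j = 0.
Proof.
move=> c2 cj; have lt : (c - 2 < j)%N by lia.
by rewrite /fall2 (bigD1 (Ordinal lt)) //= -addn2 subnK // subrr mul0r.
Qed.

(** The terms j >= c contain the factor c - c. For c = 0 or 1 there is no such factor, x and x - 1
    having been divided out. *)
Lemma cofactor_series_stable d e N u c : (2 <= c)%N -> (c <= N)%N ->
  cofactor_series d e N u c%:R = cofactor_series d e c u c%:R.
Proof.
move=> c2 cN; congr (_ + _ * _).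
rewrite -!(big_mkord xpredT (fun j => e j * u ^+ j.+2 * fall2 c%:R j.+2)).
rewrite (@big_cat_nat _ _ _ c) //= [X in _ + X]big1_seq ?addr0 // => j.
rewrite mem_index_iota => /andP[_ /andP[cj _]].
by rewrite fall2_eq0 ?mulr0 //; lia.
Qed.

Lemma subr_sum_factor x y N (f h : nat -> padic p) :
  (forall j, exists k, f j - h j = (x - y) * k) ->
  exists k, \sum_(j < N) f j - \sum_(j < N) h j = (x - y) * k.
Proof.
move=> fh; elim: N => [|N [k hk]]; first by exists 0; rewrite !big_ord0 subrr mulr0.
have [l hl] := fh N; exists (k + l).
by rewrite !big_ord_recr mulrDr -hk -hl /=; ring.
Qed.

Lemma fall2_sub x y j : exists k, fall2 x j - fall2 y j = (x - y) * k.
Proof.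
elim: j => [|j [k hk]]; first by exists 0; rewrite /fall2 !big_ord0 subrr mulr0.
exists (k * (x - j.+2%:R) + fall2 y j); move: hk; rewrite /fall2 !big_ord_recr /=.
move: (\prod_(i < j) _) (\prod_(i < j) _) (j.+2%:R) => B A t hk.
by transitivity ((A - B) * (x - t) + B * (x - y)); [|rewrite hk]; ring.
Qed.

Lemma exprB_factor u v j : exists k, u ^+ j - v ^+ j = (u - v) * k.
Proof. by exists (\sum_(i < j) u ^+ (j.-1 - i) * v ^+ i); apply: subrXX. Qed.

(** Modulo p only d u (x - 2) varies, so g is an isometry in x as soon as d u is a unit. *)
Lemma cofactor_series_subr d e N u x y : exists k,
  cofactor_series d e N u x - cofactor_series d e N u y = (x - y) * (d * u + p%:R * k).
Proof.
have [|k hk] := @subr_sum_factor x y N (fun j => e j * u ^+ j.+2 * fall2 x j.+2)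
    (fun j => e j * u ^+ j.+2 * fall2 y j.+2).
  move=> j; have [l hl] := fall2_sub x y j.+2; exists (e j * u ^+ j.+2 * l).
  by rewrite -mulrBr hl mulrCA.
exists k; rewrite mulrDr [(x - y) * (p%:R * k)]mulrCA -hk /cofactor_series; ring.
Qed.

(** The same in the variable u, with slope d (x - 2) modulo p; it yields the uniqueness of the
    exceptional q. *)
Lemma cofactor_series_subl d e N u v x : exists k,
  cofactor_series d e N u x - cofactor_series d e N v x =
  (u - v) * (d * (x - 2%:R) + p%:R * k).
Proof.
have [|k hk] := @subr_sum_factor u v N (fun j => e j * u ^+ j.+2 * fall2 x j.+2)
    (fun j => e j * v ^+ j.+2 * fall2 x j.+2).
  move=> j; have [l hl] := exprB_factor u v j.+2; exists (e j * l * fall2 x j.+2).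
  by rewrite -mulrBl -mulrBr hl; ring.
exists k; rewrite mulrDr [(u - v) * (p%:R * k)]mulrCA -hk /cofactor_series; ring.
Qed.

End SeriesDifferences.

(** * The case p = 3 and v(q - 1) = 1 *)

Section Ternary.
Variable e : nat -> padic 3.
Hypothesis excessE : forall u c N, (c <= N)%N ->
  2%:R * excess (1 + 3%:R * u) c =
  3%:R * u * (c%:R * (c%:R - 1)) * cofactor_series 1 e N u c%:R.
Implicit Types (u v x y z a : padic 3) (n k c : nat).

Let pr3 : prime 3 := isT.

Definition cofactor u c : padic 3 := cofactor_series 1 e c u c%:R.

(* cofactor is only defined at natural numbers, and is the value of g there
   only from 2 on: the partial sum up to k = c + 3 is not complete at 0 and 1. *)
Definition is_root u a := forall k c, (2 <= c)%N ->
  pdvd k (cofactor u c) = pdvd k (c%:R - a).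

Lemma unit_addp x y : ~~ pdvd 1 x -> ~~ pdvd 1 (x + 3%:R * y).
Proof. by move=> hx; rewrite pdvdDr // pdvdMr // pdvd_nat. Qed.

Lemma pdvd_cofactor_sub u k c1 c2 : ~~ pdvd 1 u -> (2 <= c1)%N -> (2 <= c2)%N ->
  pdvd k (cofactor u c1 - cofactor u c2) = pdvd k (c1%:R - c2%:R : padic 3).
Proof.
move=> hu h1 h2; rewrite /cofactor.
rewrite -(cofactor_series_stable _ _ _ h1 (leq_maxl c1 c2)).
rewrite -(cofactor_series_stable _ _ _ h2 (leq_maxr c1 c2)).
have [h ->] := cofactor_series_subr 1 e (maxn c1 c2) u c1%:R c2%:R.
by rewrite mulrC pdvd_unitM // unit_addp // mul1r.
Qed.

(** An isometry is injective modulo 3^n, hence attains 0; the shift to i + 2 keeps to arguments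
    where [cofactor] is the value of g. *)
Lemma root_mod u n : ~~ pdvd 1 u -> exists c, (2 <= c)%N /\ pdvd n (cofactor u c).
Proof.
move=> hu; have [i j|i hi] := @pdvd_inj_surj 3 pr3 (fun i => cofactor u i.+2) n.
  rewrite pdvd_cofactor_sub // => /red_eqP; rewrite !padic_natE !modz_nat => -[].
  by move/eqP; rewrite -[i.+2]addn2 -[j.+2]addn2 eqn_modDr => /eqP.
by exists i.+2.
Qed.

(** The roots modulo 3^n cohere because g is an isometry, and a is their limit. *)
Lemma root_exists u : ~~ pdvd 1 u -> exists a, is_root u a.
Proof.
move=> hu; have [s hs] := boolp.choice (fun n => root_mod n hu).
have coh n : red ((s n)%:R : padic 3) n =
    (red ((s n.+1)%:R : padic 3) n.+1 %% (3 ^ n)%N%:Z)%Z.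
  rewrite -redP; apply/red_eqP.
  rewrite -(pdvd_cofactor_sub _ hu) ?(hs _).1 // pdvdB ?(hs _).2 //.
  exact: (pdvd_leq (leqnSn n) (hs _).2).
exists (Padic coh) => k c c2.
rewrite -[cofactor u c](subrK (cofactor u (s k))) pdvdDr ?(hs _).2 //.
by rewrite pdvd_cofactor_sub ?(hs _).1.
Qed.

Lemma pdvd_excess u a n c : is_root u a -> ~~ pdvd 1 u ->
  pdvd n (excess (1 + 3%:R * u) c) =
  pdvd n.-1 (c%:R * (c%:R - 1) * (c%:R - a)).
Proof.
move=> ra hu; have u2 : ~~ pdvd 1 (2%:R : padic 3) by rewrite pdvd_nat.
rewrite -(pdvd_unitM pr3 _ _ u2) (excessE _ (leqnn c)) -!mulrA -[3%:R]expr1.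
rewrite pdvd_pXM // pdvd_unitM // subn1 !mulrA.
(* At c = 0 and 1 [is_root] says nothing, but both products are 0. *)
case: c => [|[|c]]; first by rewrite !mul0r.
  by rewrite subrr mulr0 !mul0r.
have tr x y z : (forall k, pdvd k y -> pdvd k z) -> pdvd n.-1 (x * y) -> pdvd n.-1 (x * z).
  move=> yz /(pdvdM_split pr3)[i [im /(pdvdP pr3)[s ->] /yz /(pdvdP pr3)[t ->]]].
  apply/(pdvdP pr3); exists (s * t).
  by rewrite mulrACA -exprD subnKC.
by apply/idP/idP; apply: tr => k; rewrite -[cofactor_series _ _ _ _ _]/(cofactor u c.+2) ra.
Qed.

Lemma padic_lift z n : exists c, (2 <= c)%N /\ pdvd n (c%:R - z).
Proof.
(* Adding 3^(n+1) keeps the residue and forces c >= 2 even for n = 0. *)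
exists (`|red z n.+1| + 3 ^ n.+1)%N; split.
  have : (0 < 3 ^ n)%N by rewrite expn_gt0.
  by rewrite expnS; lia.
apply: (@pdvd_leq _ _ n.+1) => //; rewrite pdvd_subnat //.
by rewrite modnDr.
Qed.

(** Replacing z by a nearby natural number c changes the cubic by a multiple of c - z. *)
Lemma fixed_ternary u z a n : is_root u a -> ~~ pdvd 1 u -> U 1 (1 + 3%:R * u) ->
  fixed_mod (1 + 3%:R * u) n z <-> pdvd n.-1 (z * (z - 1) * (z - a)).
Proof.
move=> ra hu Uq; have [c [_ cz]] := padic_lift z n.
rewrite (@fixed_modE _ pr3 _ _ _ c) //; last by apply/esym/red_eqP.
rewrite (pdvd_excess _ _ ra) //.
have {}cz : pdvd n.-1 (c%:R - z) by apply: pdvd_leq cz; apply: leq_pred.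
rewrite -(subrK z c%:R); move: (c%:R - z) cz => y hy.
rewrite (_ : (y + z) * (y + z - 1) * (y + z - a) = z * (z - 1) * (z - a) +
  y * ((y + z - 1) * (y + z - a) + z * (y + z - a) + z * (z - 1))); last by ring.
by rewrite pdvdDr // pdvdMr.
Qed.

Lemma iota_fixed_ternary u z a : is_root u a -> ~~ pdvd 1 u -> U 1 (1 + 3%:R * u) ->
  iota_q (1 + 3%:R * u) z = z <-> [\/ z = 0, z = 1 | z = a].
Proof.
move=> ra hu Uq; split=> [fz|hz].
  have : z * (z - 1) * (z - a) = 0.
    apply: (@pdvd_eq0 3) => n; rewrite -[n]/(n.+1.-1).
    by apply/(fixed_ternary _ _ ra hu Uq); rewrite /fixed_mod fz.
  move=> /(padic_mulf_eq0 pr3)[/(padic_mulf_eq0 pr3)[]|].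
  - by move=> ->; constructor 1.
  - by move=> /subr0_eq ->; constructor 2.
  - by move=> /subr0_eq ->; constructor 3.
apply: padic_ext => n; apply/(fixed_ternary _ _ ra hu Uq).
suff -> : z * (z - 1) * (z - a) = 0 by rewrite pdvd0.
by case: hz => ->; rewrite !(subrr, mul0r, mulr0).
Qed.

Lemma no_nontrivial_ternary u a : is_root u a -> ~~ pdvd 1 u -> U 1 (1 + 3%:R * u) ->
  no_nontrivial_fixpoint (1 + 3%:R * u) <-> a = 0 \/ a = 1.
Proof.
move=> ra hu Uq; split=> [|ha z /(iota_fixed_ternary _ ra hu Uq)[]]; first 1 last.
- by left. - by right. - by move=> ->.
by apply; apply/(iota_fixed_ternary _ ra hu Uq); constructor 3.
Qed.

(** This is g(a) = 0 modulo 3, where only the terms k = 2 and k = 3 survive. *)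
Lemma pdvd1_root u a : is_root u a -> pdvd 1 (1 + u * (a - 2%:R)).
Proof.
move=> ra; have [c [c2 hc]] := padic_lift a 1.
have : pdvd 1 (cofactor u c) by rewrite ra.
rewrite /cofactor /cofactor_series pdvdDr; last by rewrite pdvdMr // pdvd_nat.
rewrite mul1r (_ : 1 + u * (c%:R - 2%:R) = 1 + u * (a - 2%:R) + u * (c%:R - a)); last by ring.
by rewrite pdvdDr // pdvdMl.
Qed.

Lemma unit3_cases u : ~~ pdvd 1 u -> pdvd 1 (u - 1) || pdvd 1 (u - 2%:R).
Proof.
rewrite -(pdvdN 1 u) -(pdvdN 1 (u - 1)) -(pdvdN 1 (u - 2%:R)) !opprB.
move: (pdvd_subnat pr3 1 u 0) (pdvd_subnat pr3 1 u 1) (pdvd_subnat pr3 1 u 2).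
rewrite mulr0n sub0r mulr1n expn1 => -> -> ->.
by have := ltn_pmod `|red u 1| (ltn0Sn 2); case: (_ %% _)%N => [|[|[|]]].
Qed.

Lemma root_1mod u a : is_root u a -> pdvd 1 (u - 1) -> pdvd 1 (a - 1).
Proof.
move=> /pdvd1_root h hu.
rewrite (_ : a - 1 = 1 + u * (a - 2%:R) - (u - 1) * (a - 2%:R)); last by ring.
by rewrite pdvdB // pdvdMr.
Qed.

Lemma root_2mod u a : is_root u a -> pdvd 1 (u - 2%:R) -> pdvd 1 a.
Proof.
move=> /pdvd1_root h hu; have u2 : ~~ pdvd 1 (2%:R : padic 3) by rewrite pdvd_nat.
rewrite -(pdvd_unitM pr3 _ _ u2).
rewrite (_ : 2%:R * a = 1 + u * (a - 2%:R) - (u - 2%:R) * (a - 2%:R) + 3%:R);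
  last by ring.
by rewrite pdvdD ?pdvd_nat // pdvdB // pdvdMr.
Qed.

Lemma root_inj u v a : is_root u a -> is_root v a -> ~~ pdvd 1 (a - 2%:R) -> u = v.
Proof.
move=> ru rv ha; apply/subr0_eq/pdvd_eq0 => n.
(* Level n + 1 ensures c = a modulo 3 also for n = 0, so that c - 2 is a unit. *)
have [c [c2 hc]] := padic_lift a n.+1.
have [h hE] := cofactor_series_subl 1 e c u v c%:R.
have hu : pdvd n.+1 (cofactor u c) by rewrite ru.
have hv : pdvd n.+1 (cofactor v c) by rewrite rv.
have := pdvdB hu hv.
rewrite /cofactor hE [_ * (_ + _)]mulrC pdvd_unitM //; first exact: pdvd_leq.
apply: unit_addp; rewrite mul1r.
rewrite (_ : c%:R - 2%:R = a - 2%:R + (c%:R - a)); last by ring.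
by rewrite pdvdDr // (pdvd_leq _ hc).
Qed.

(* x and y are 0 and 1 in the order for which a is congruent to y modulo 3. *)
Section Counting.
Variables (u a x y : padic 3).
Hypotheses (ra : is_root u a) (hu : ~~ pdvd 1 u).
Hypotheses (Uq : U 1 (1 + 3%:R * u)) (ay : pdvd 1 (a - y)).
Hypothesis xyE : forall z, z * (z - 1) = (z - x) * (z - y).
Hypothesis xy : ~~ pdvd 1 (x - y).

Lemma pdvd_excess_roots n c : pdvd n (excess (1 + 3%:R * u) c) =
  pdvd n.-1 ((c%:R - x) * ((c%:R - y) * (c%:R - a))).
Proof. by rewrite (pdvd_excess _ _ ra) // xyE mulrA. Qed.

Lemma nfix_stable_ternary : a <> y ->
  exists k : nat, \forall n \near \oo, nfix (1 + 3%:R * u) n = k.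
Proof.
move=> nay; have [b [w [bw hw]]] := padic_decomp pr3 (contra_not (fun h => subr0_eq h) nay).
have nxy : x != y by apply/eqP => h; move: xy; rewrite h subrr pdvd0.
have nxa : x != a by apply/eqP => h; move: xy; rewrite h ay.
have nya : y != a by apply/eqP => h; apply: nay.
have us : uniq [:: x; y; a] by rewrite /= !inE negb_or nxy nxa nya.
(* The factor 3 of q - 1 costs 1 at every root; y and a, at distance 3^(-b), cost b more. From n =
   2b + 2 on, [b.*2 < n.-1] as [pdvd_close_roots] requires. *)
apply: (@nfix_stable 3 pr3 _ [:: (1, x); (b.+1, y); (b.+1, a)] b.*2.+2 Uq us).
move=> n c nb; rewrite /= pdvd_excess_roots pdvdM_coprime //; last first.
  apply: contra xy => /andP[hx hya].
  have [hy|hy] := boolP (pdvd 1 (c%:R - y)).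
    rewrite (_ : x - y = c%:R - y - (c%:R - x)); last by ring.
    by rewrite pdvdB.
  rewrite pdvd_unitM // in hya.
  rewrite (_ : x - y = c%:R - a + (a - y) - (c%:R - x)); last by ring.
  by rewrite pdvdB // pdvdD.
rewrite (pdvd_close_roots pr3 _ _ bw hw); last by clear -nb; lia.
have -> : (n - b.+1 = n.-1 - b)%N by clear; lia.
by rewrite orbF subn1.
Qed.

(** At the double root y, c = y modulo 3^(n/2) already makes (c - y)^2 divisible by 3^(n-1), and
    there are 3^(n - n/2) such classes, with n/2 rounded down. *)
Lemma nfix_unbounded_ternary n : a = y -> (n./2 <= nfix (1 + 3%:R * u)%R n)%N.
Proof.
move=> ay'; rewrite nfixE //.
have [le_half le_sub le_double] :
    [/\ n./2 <= n, n./2 <= n - n./2 & n.-1 <= n./2 + n./2]%N by clear; split; lia.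
apply: (@leq_trans (3 ^ (n - n./2))%N).
  by rewrite (leq_trans le_sub) // ltnW // ltn_expl.
rewrite -(card_pdvd pr3 y le_half); apply: subset_leq_card; apply/fintype.subsetP => c.
rewrite !inE pdvd_excess_roots ay' => /(pdvdP pr3)[s ->].
apply: pdvdMl; apply: (pdvd_leq le_double).
by rewrite -mulrA pdvd_pX // pdvdMl //; apply/(pdvdP pr3); exists s.
Qed.

End Counting.

Lemma U1U2_ternary q : (U 1 `\` U 2) q ->
  exists u, [/\ q = 1 + 3%:R * u, ~~ pdvd 1 u & U 1 (1 + 3%:R * u)].
Proof.
move=> [Uq]; have [u qE] := Uq; rewrite expr1 in qE; rewrite qE in Uq *.
move=> nU2; exists u; split=> //; apply/negP => hu; apply: nU2.
apply/(U_pdvdP pr3); rewrite addrAC subrr add0r -[3%:R]expr1.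
by rewrite pdvd_pXM.
Qed.

Lemma U1U2_ternaryE u : ~~ pdvd 1 u -> U 1 (1 + 3%:R * u) ->
  (U 1 `\` U 2) (1 + 3%:R * u).
Proof.
move=> hu Uq; split=> // /(U_pdvdP pr3).
by rewrite addrAC subrr add0r -[3%:R]expr1 pdvd_pXM // (negbTE hu).
Qed.

Lemma red2_ternary u (t : nat) :
  reflect (red (1 + 3%:R * u) 2 = red ((1 + 3 * t)%:R : padic 3) 2) (pdvd 1 (u - t%:R)).
Proof.
have -> : pdvd 1 (u - t%:R) = pdvd 2 (1 + 3%:R * u - (1 + 3 * t)%:R).
  rewrite natrD natrM (_ : 1 + 3%:R * u - _ = 3%:R * (u - t%:R)); last by ring.
  by rewrite -[3%:R]expr1 pdvd_pXM.
exact: red_eqP.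
Qed.

(** The residue t decides which of 0 and 1 can be the root, so a competitor v has the same root a;
    as a - 2 is a unit, [root_inj] gives v = u. *)
Lemma is_exceptional_ternary u a (t : nat) : is_root u a -> ~~ pdvd 1 u ->
  U 1 (1 + 3%:R * u) -> pdvd 1 (u - t%:R) -> a = 0 \/ a = 1 ->
  (forall v b, is_root v b -> pdvd 1 (v - t%:R) -> b = 0 \/ b = 1 -> b = a) ->
  is_exceptional (1 + 3 * t) (1 + 3%:R * u).
Proof.
move=> ra hu Uq ut a01 aU; split.
  split; [exact: U1U2_ternaryE | exact/red2_ternary |].
  exact/(no_nontrivial_ternary ra hu Uq).
move=> _ [/U1U2_ternary[v [-> hv Uv]] /red2_ternary vt].
have [b rb] := root_exists hv.
move=> /(no_nontrivial_ternary rb hv Uv) b01.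
have ba := aU _ _ rb vt b01; rewrite ba in rb; rewrite (root_inj ra rb) //.
by case: a01 => ->; rewrite -pdvdN ?opprB ?subr0 ?sub0r ?opprK ?pdvd_nat // -natrB.
Qed.

Lemma nfix_stable_ternary_simple u a : is_root u a -> ~~ pdvd 1 u -> U 1 (1 + 3%:R * u) ->
  a <> 0 -> a <> 1 -> exists k : nat, \forall n \near \oo, nfix (1 + 3%:R * u) n = k.
Proof.
move=> ra hu Uq a0 a1; have u1 := pdvd_1 pr3.
case/orP: (unit3_cases hu) => ut.
  have u01 : ~~ pdvd 1 (0 - 1 : padic 3) by rewrite sub0r pdvdN.
  apply: (nfix_stable_ternary ra hu Uq (root_1mod ra ut) _ u01 a1) => z.
  by rewrite subr0.
have u10 : ~~ pdvd 1 (1 - 0 : padic 3) by rewrite subr0.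
have ra0 : pdvd 1 (a - 0) by rewrite subr0; apply: root_2mod ut.
apply: (nfix_stable_ternary ra hu Uq ra0 _ u10 a0) => z.
by rewrite subr0 mulrC.
Qed.

Lemma nfix_ternary_ge u a n : is_root u a -> ~~ pdvd 1 u -> U 1 (1 + 3%:R * u) ->
  a = 0 \/ a = 1 -> (n./2 <= nfix (1 + 3%:R * u)%R n)%N.
Proof.
move=> ra hu Uq; case=> aE.
  by apply: (@nfix_unbounded_ternary u a 1 0) => // z; rewrite subr0 mulrC.
by apply: (@nfix_unbounded_ternary u a 0 1) => // z; rewrite subr0.
Qed.

Lemma double_root_exceptional u a : is_root u a -> ~~ pdvd 1 u ->
  U 1 (1 + 3%:R * u) -> a = 0 \/ a = 1 ->
  is_exceptional 7 (1 + 3%:R * u) \/ is_exceptional 4 (1 + 3%:R * u).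
Proof.
move=> ra hu Uq a01; have u1 := pdvd_1 pr3.
have e1 (b : padic 3) : pdvd 1 (b - 1) -> b = 0 \/ b = 1 -> b = 1.
  by move=> hb [bE|//]; move: hb; rewrite bE sub0r pdvdN (negbTE u1).
have e0 (b : padic 3) : pdvd 1 b -> b = 0 \/ b = 1 -> b = 0.
  by move=> hb [//|bE]; move: hb; rewrite bE (negbTE u1).
(* If u = 1 mod 3, then q = 4 mod 9 and the root is 1; if u = 2 mod 3, then q = 7 mod 9 and the root
   is 0. *)
case/orP: (unit3_cases hu) => ut; [right|left].
  apply: (@is_exceptional_ternary u a 1) => // v b rb vt b01.
  by rewrite (e1 _ (root_1mod rb vt) b01) (e1 _ (root_1mod ra ut) a01).
apply: (@is_exceptional_ternary u a 2) => // v b rb vt b01.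
by rewrite (e0 _ (root_2mod rb vt) b01) (e0 _ (root_2mod ra ut) a01).
Qed.

End Ternary.

(** * Conclusion: the cases p = 3, p > 3 and p = 2 *)

Unset Implicit Arguments.

Theorem corollary6p4 (p : nat) (hp : prime p) (q : padic p)
    (hq : U 1 q) (hq1 : q <> 1) :
  (~ (p = 3%N /\ (is_exceptional 7 q \/ is_exceptional 4 q)) ->
     exists c : nat, \forall n \near \oo, nfix q n = c) /\
  (p = 3%N /\ (is_exceptional 7 q \/ is_exceptional 4 q) ->
     nfix q n @[n --> \oo] --> \oo).
Proof.
have [d [e [d3 dp excessE]]] := excess_expansion hp.
have [p3|p3] := eqVneq p 3%N.
  move: hp q hq hq1 d e d3 dp excessE; rewrite p3 => hp q hq hq1 d e + _.
  move=> /(_ erefl) -> excessE.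
  have [u qE] := hq; rewrite expr1 in qE; rewrite {}qE in hq hq1 *.
  (* If 3 divides u, then g is a unit, and q lies in [U 2], so it is not exceptional. *)
  have [hu|hu] := boolP (pdvd 1 u).
    split=> [_|[_ exc]].
      apply: (@nfix_stable_unit 3 hp 1 e) => //.
      - by move=> u0; apply: hq1; rewrite u0 mulr0 addr0.
      - by move=> c; apply: excessE.
      - by move=> c; apply: cofactor_series_unit; rewrite // mul1r.
    have [v [/addrI vu hv _]] : exists v, [/\ 1 + 3%:R * u = 1 + 3%:R * v, ~~ pdvd 1 v
        & U 1 (1 + 3%:R * v)].
      by case: exc => -[[+ _ _] _]; apply: U1U2_ternary.
    have : pdvd 2 (3%:R * u) by rewrite -[3%:R]expr1 pdvd_pXM.
    by rewrite vu -[3%:R]expr1 pdvd_pXM // (negbTE hv).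
  have [a ra] := root_exists e hu; split=> [nexc|[_ exc]].
    apply: (nfix_stable_ternary_simple excessE ra) => // a01; apply: nexc; split=> //;
      apply: (double_root_exceptional excessE ra) => //; by [left|right].
  have a01 : a = 0 \/ a = 1.
    by apply/(no_nontrivial_ternary excessE ra hu hq); case: exc => -[[]].
  move=> A [M _ hM]; exists (M.*2)%N => // n /= Mn; apply: hM => /=.
  by rewrite (leq_trans _ (nfix_ternary_ge excessE n ra hu hq a01)) //; clear -Mn; lia.
split=> [_|[p3' _]]; last by rewrite p3' in p3.
have [d' dE] := dp p3.
have [p2|p2] := eqVneq p 2%N; last first.
  have baseE : base p = p by rewrite /base (negbTE p2).
  have [u qE] := hq; rewrite expr1 -[p in p%:R]baseE in qE; rewrite qE in hq hq1 *.
  apply: (@nfix_stable_unit p hp d e) => //.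
  - by move=> u0; apply: hq1; rewrite u0 mulr0 addr0.
  - by move=> c; apply: excessE.
  - by move=> c; apply: cofactor_series_unit; rewrite // dE -mulrA pdvdMr // pdvd_nat expn1.
clear p3 d3 dp; subst p.
have [r qE] := hq; rewrite expr1 in qE.
have [hr|hr] := boolP (pdvd 1 r).
  have /(pdvdP hp)[u rE] := hr.
  have {}qE : q = 1 + (base 2)%:R * u by rewrite qE rE expr1 mulrA -natrM.
  rewrite qE in hq hq1 *; apply: (@nfix_stable_unit 2 hp d e) => //.
  - by move=> u0; apply: hq1; rewrite u0 mulr0 addr0.
  - by move=> c; apply: excessE.
  - by move=> c; apply: cofactor_series_unit; rewrite // dE -mulrA pdvdMr // pdvd_nat.
have : pdvd 1 (1 - r).
  move: (pdvd_subnat hp 1 r 0) (pdvd_subnat hp 1 r 1) hr.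
  rewrite mulr0n sub0r mulr1n pdvdN expn1 => -> ->.
  by have := ltn_pmod `|red r 1| (ltn0Sn 1); case: (_ %% _)%N => [|[|]].
move=> /(pdvdP hp)[t tE].
apply: (@nfix_stable_trivial 2 hp q 0 0) => // n c _.
(* With r = 1 - 2t, 1 + q = 2 + 2r = 4 (1 - t). *)
rewrite subn0; apply: (@excess_dyadic q (1 - t)) => //.
rewrite qE (_ : r = 1 - (1 - r)); last by ring.
by rewrite tE; ring.
Qed.
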